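(* For every integer $n\geq 1$, $$\sum_{\pi\in \mathcal{SP}_n(132)}x^{\mathrm{des}(\pi)+1}y^{\mathrm{rpk}(\pi)}z^{\mathrm{exddes}(\pi)}q^{\mathrm{inv}(\pi)}=\sum_{p\in \Pi_{n}}x^{\mathrm{block}(p)}y^{\mathrm{nsingleton}(p)}z^{\mathrm{singleton}(p)}q^{\mathrm{fr}(p)}.$$
   Context: Let $\mathfrak{S}_n$ be the set of permutations of $[n]=\{1,\dots,n\}$, written as words $\pi=\pi(1)\cdots\pi(n)$. A word of distinct integers contains $132$ as a consecutive pattern if it has three adjacent entries $a,b,c$ (in this order) with $a<c<b$. For $\pi\in\mathfrak{S}_n$ and $k\in[n]$, the subword of $\pi$ restricted to $[k]$ is the word formed by the letters $1,\dots,k$ in the order in which they appear in $\pi$. The permutation $\pi$ avoids simsun pattern $132$ if for all $k\in[n]$ the subword of $\pi$ restricted to $[k]$ does not contain the consecutive pattern $132$. $\mathcal{SP}_n(132)$ denotes the set of permutations in $\mathfrak{S}_n$ that avoid simsun pattern $132$. Statistics on $\pi\in\mathfrak{S}_n$: - $\mathrm{des}(\pi)$: number of indices $i\in[n-1]$ with $\pi(i)>\pi(i+1)$. - $\mathrm{rpk}(\pi)$: number of right peaks, i.e. entries $\pi(i)$ with $i\in\{2,\dots,n\}$ and $\pi(i-1)<\pi(i)>\pi(i+1)$, where $\pi(n+1)=0$. - $\mathrm{exddes}(\pi)$: number of exterior double descents, i.e. entries $\pi(i)$ with $i\in[n]$ and $\pi(i-1)>\pi(i)>\pi(i+1)$,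 where $\pi(0)=+\infty$ and $\pi(n+1)=0$. - $\mathrm{inv}(\pi)$: number of inversions, i.e. pairs $(\pi(i),\pi(j))$ with $i<j$ and $\pi(i)>\pi(j)$. $\Pi_n$ denotes the set of all set partitions of $[n]$. A partition is written $p=B_1/B_2/\cdots/B_k$ in standard form, with $\min B_1<\min B_2<\cdots<\min B_k$. Statistics on $p$: - $\mathrm{block}(p)=k$, the number of blocks. - $\mathrm{singleton}(p)$: number of blocks with exactly one element. - $\mathrm{nsingleton}(p)$: number of blocks with at least two elements. - $\mathrm{fr}(p)$: number of free rises, i.e. pairs $(c,d)$ with $c\in B_s$, $d\in B_t$, $1\le s<t\le k$ and $c<d$. *)

(* Defs.v *)
From mathcomp Require Import all_boot all_fingroup.

Set Implicit Arguments.
Unset Strict Implicit.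
Unset Printing Implicit Defensive.

(* Words are [seq nat] with positions and letters counted from 1, while the   *)
(* ground set [n] of permutations and set partitions is 'I_n, that is         *)
(* {0, ..., n-1}; [word_of_perm] applies the shift i |-> i.+1 to letters.     *)

Section Words.

Implicit Types (w : seq nat) (i k : nat).

(* [letter w i] is w(i) for 1 <= i <= size w.  The default value makes        *)
(* w(i) = 0 for i > size w, which is the convention pi(n+1) = 0.  The value   *)
(* at i = 0 is never used: the convention pi(0) = +oo is spelled out in       *)
(* [exddes].                                                                  *)
Definition letter w i : nat := nth 0 (0 :: w) i.

Definition contains132 w : bool :=
  has (fun i => letter w i < letter w i.+2 < letter w i.+1)
      (iota 1 (size w - 2)).

Definition restrict_word k w : seq nat := [seq a <- w | 1 <= a <= k].

(* For w in S_n, i.e. size w = n; k ranges over 1, ..., n. *)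
Definition avoids_simsun132 w : bool :=
  all (fun k => ~~ contains132 (restrict_word k w)) (iota 1 (size w)).

Definition des w : nat :=
  count (fun i => letter w i > letter w i.+1) (iota 1 (size w - 1)).

Definition rpk w : nat :=
  count (fun i => (letter w i.-1 < letter w i) && (letter w i > letter w i.+1))
        (iota 2 (size w - 1)).

(* The disjunct i == 1 encodes pi(0) = +oo. *)
Definition exddes w : nat :=
  count (fun i => ((i == 1) || (letter w i.-1 > letter w i))
                  && (letter w i > letter w i.+1))
        (iota 1 (size w)).

Definition inversions w : nat :=
  count (fun ij => (ij.1 < ij.2) && (letter w ij.1 > letter w ij.2))
        [seq (i, j) | i <- iota 1 (size w), j <- iota 1 (size w)].

End Words.

Definition word_of_perm (n : nat) (s : 'S_n) : seq nat :=
  [seq (s i).+1 | i <- enum 'I_n].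

Section SetPartitions.

Variable n : nat.
Implicit Types (B : {set 'I_n}) (P : {set {set 'I_n}}).

(* Equal to min B for nonempty B, all elements of 'I_n being smaller than n. *)
Definition min_block B : nat := \big[minn/n]_(i in B) (i : nat).

Definition standard_form P : seq {set 'I_n} :=
  sort (fun B C => min_block B <= min_block C) (enum P).

Definition block P : nat := #|P|.

Definition singleton P : nat := #|[set B in P | #|B| == 1]|.

Definition nsingleton P : nat := #|[set B in P | 2 <= #|B|]|.

(* Block indices run over 0, ..., block P - 1. *)
Definition fr P : nat :=
  #|[set cd : 'I_n * 'I_n |
      [exists s : 'I_(block P), exists t : 'I_(block P),
        [&& s < t,
            cd.1 \in nth set0 (standard_form P) s,
            cd.2 \in nth set0 (standard_form P) t
          & cd.1 < cd.2]]]|.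

End SetPartitions.

(* Main.v *)
Require Import Defs.
From HB Require Import structures.
From mathcomp Require Import all_boot all_order all_fingroup all_algebra.
From mathcomp Require Import zify.
Set Implicit Arguments.
Unset Strict Implicit.
Unset Printing Implicit Defensive.
Import GRing.Theory.

(** The identity comes from a bijection that preserves all four statistics.
    Cut a permutation, seen as a word, into its maximal increasing runs.  The
    runs are the blocks of a set partition, and the word avoids the simsun
    pattern 132 exactly when the minima of its runs decrease from left to right.
    Hence the partition B_1/B_2/.../B_k in standard form corresponds to the word
    B_k ... B_2 B_1, each block being written in increasing order
    ([partition_word]), and [image_perm_of_partition] says that these words are
    exactly those of the avoiding permutations.

    Why the minima decrease: if a run r is followed by a run starting with c and
    min r < c, then r has adjacent letters a < c < b, since c is smaller than
    the last letter of r; after restriction to the letters at most b, what is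
    left of r ends in a b, so that a b c is a consecutive 132
    ([simsun132_witness]).  Conversely, a consecutive a b c with a < c < b would
    be the end of a run and the start of the next one, where c < min r <= a
    ([contains132_run]); and restricting to [k] truncates each run from the
    right, so a word whose run minima decrease keeps this property
    ([restrict_flatten]).

    Under the bijection, each descent separates two consecutive runs, so
    des + 1 = block.  The last letter of a run is a right peak if the run has at
    least two letters, and an exterior double descent otherwise; no other letter
    is either.  Finally, two letters c < d are inverted when d stands in a run
    to the left of that of c, that is, in a block of larger index: an inversion
    is a free rise ([inversions_fr]). *)

(** * Words with decreasing run minima *)

(** Starting the path at 0 makes the letters positive. *)
Definition increasing_run (r : seq nat) : bool := (r != [::]) && path ltn 0 r.

Definition decreasing_runs (rs : seq (seq nat)) : bool :=
  all increasing_run rs && sorted gtn (map (head 0) rs).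

Fixpoint runs (w : seq nat) : seq (seq nat) :=
  if w is a :: v then
    if runs v is r :: rs then
      if a < head 0 r then (a :: r) :: rs else [:: a] :: r :: rs
    else [:: [:: a]]
  else [::].

Lemma letter1 w : letter w 1 = head 0 w. Proof. by case: w. Qed.

(** When [w] has fewer than two letters, [letter w 2 = 0] makes the first disjunct
    false.  This recursion and those for the other statistics replace positions in
    a word by induction on it. *)
Lemma contains132_cons a w :
  contains132 (a :: w) = (a < letter w 2 < letter w 1) || contains132 w.
Proof.
case: w => [|b [|c w]] //.
rewrite /contains132 [size _]/= [size (b :: _)]/= !subSS !subn0.
rewrite -[iota 1 _.+1]/(1 :: iota (1 + 1) _) -[has _ (_ :: _)]/(_ || has _ _).
congr (_ || _); rewrite iotaDl has_map.
by apply: eq_in_has => i; rewrite mem_iota /= => /andP[i_gt0 _]; case: i i_gt0.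
Qed.

Lemma contains132_catr r w : contains132 w -> contains132 (r ++ w).
Proof. by move=> cw; elim: r => //= a r IH; rewrite contains132_cons IH orbT. Qed.

(** The common shape of [rpk] and of the part of [exddes] that concerns
    positions from 2 on. *)
Definition window_count (p : nat -> nat -> nat -> bool) (w : seq nat) : nat :=
  count (fun i => p (letter w i.-1) (letter w i) (letter w i.+1))
        (iota 2 (size w - 1)).

Lemma window_count_cons p a w :
  window_count p (a :: w) =
    ((w != [::]) && p a (letter w 1) (letter w 2)) + window_count p w.
Proof.
case: w => [|b w] //; rewrite /window_count [size _]/= !subSS !subn0 /=.
congr (_ + _); rewrite -[3]/(1 + 2) iotaDl count_map.
by apply: eq_in_count => -[|[|i]]; rewrite ?mem_iota.
Qed.

Lemma rpkE w : rpk w = window_count (fun a b c => (a < b) && (b > c)) w.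
Proof. by []. Qed.

Lemma exddes_cons a w :
  exddes (a :: w) =
    (a > letter w 1) + window_count (fun a b c => (a > b) && (b > c)) (a :: w).
Proof.
rewrite /exddes /window_count [size _]/= !subSS subn0.
rewrite -[iota 1 _.+1]/(1 :: iota 2 _) -[count _ (_ :: _)]/(_ + count _ _).
by congr (_ + _); apply: eq_in_count => -[|[|i]]; rewrite ?mem_iota.
Qed.

Lemma des_cons a w :
  des (a :: w) = ((w != [::]) && (a > letter w 1)) + des w.
Proof.
case: w => [|b w] //; rewrite /des [size _]/= [size (b :: _)]/= !subSS !subn0.
rewrite -[iota 1 _.+1]/(1 :: iota (1 + 1) _) -[count _ (_ :: _)]/(_ + count _ _).
congr (_ + _); rewrite iotaDl count_map.
by apply: eq_in_count => -[|i]; rewrite ?mem_iota.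
Qed.

(** The next four lemmas tell how each statistic changes when an increasing run
    [a :: r] is put in front of a word [v] that starts below [a].  The empty [v]
    is included because [head 0 [::] = 0], in accordance with pi(n+1) = 0. *)
Section PrependRun.

Implicit Types (a : nat) (r v : seq nat).

(** A new 132 would use the last ascent of the run, whose smaller letter is at
    least [a], and the first letter of [v], which is less than [a]: a window that
    starts at the last letter of the run begins with a descent. *)
Lemma contains132_run a r v :
  path ltn a r -> head 0 v < a -> contains132 ((a :: r) ++ v) = contains132 v.
Proof.
elim: r a => [|b s IH] c /=.
  by move=> _ vc; rewrite contains132_cons letter1; case: andP => // -[]; lia.
move=> /andP[cb bs] vc; rewrite contains132_cons IH //; last exact: ltn_trans cb.
rewrite (_ : (_ < _ < _) = false) //.
by case: s bs {IH} => [|d s] /=; rewrite /letter /= ?nth0; [lia|case/andP; lia].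
Qed.

Lemma des_run a r v :
  path ltn a r -> head 0 v < a -> des ((a :: r) ++ v) = (v != [::]) + des v.
Proof.
elim: r a => [|b s IH] c /=; first by move=> _ vc; rewrite des_cons letter1 vc andbT.
move=> /andP[cb bs] vc; rewrite des_cons IH //; last exact: ltn_trans cb.
by rewrite letter1 /= ltnNge ltnW.
Qed.

(** Only the last letter of the run can be a new peak.  The first letter of [v]
    is a peak neither in [v], where it has no predecessor, nor after the run,
    where its predecessor is larger. *)
Lemma rpk_run a r v :
  path ltn a r -> head 0 v < a -> rpk ((a :: r) ++ v) = (r != [::]) + rpk v.
Proof.
rewrite !rpkE; elim: r a => [|b s IH] c /=.
  by move=> _ vc; rewrite window_count_cons letter1 ltnNge ltnW // andbF.
move=> /andP[cb bs] vc; rewrite window_count_cons IH //; last exact: ltn_trans cb.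
by case: s bs {IH} => [|d s] /=; rewrite /letter /= ?nth0; [lia|case/andP; lia].
Qed.

(** Whether the first letter of [v] counts depends only on its successor: in [v]
    because pi(0) = +oo, after the run because its predecessor is larger.  In the
    same way the run contributes its last letter just when it is its first. *)
Lemma exddes_run a r v :
  path ltn a r -> head 0 v < a -> exddes ((a :: r) ++ v) = (r == [::]) + exddes v.
Proof.
have step c s : head 0 v < c -> path ltn c s ->
    window_count (fun a b c => (a > b) && (b > c)) ((c :: s) ++ v) = exddes v.
  elim: s c => [|b s IH] c /= vc.
    move=> _; rewrite window_count_cons letter1; case: v vc => //= b v' bc.
    by rewrite exddes_cons bc.
  case/andP=> cb bs; rewrite window_count_cons IH //; last exact: ltn_trans cb.
  by rewrite letter1 /= ltnNge ltnW.
move=> ar va; rewrite exddes_cons -cat_cons step // letter1; congr (_ + _).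
by case: r ar => [|b s] /=; [rewrite va|case/andP=> ab _; rewrite ltnNge ltnW].
Qed.

End PrependRun.

Lemma increasing_runP r :
  reflect (exists a s, [/\ r = a :: s, 0 < a & path ltn a s]) (increasing_run r).
Proof.
case: r => [|a s]; first by apply: ReflectF => -[? [? []]].
apply: (iffP andP) => [[_ /andP[]]|[b [t [[-> ->] b0 bt]]]]; first by exists a, s.
by rewrite /= b0.
Qed.

(** Induction that hands over the hypotheses of the prepending lemmas; the
    minimum of the next run is the first letter of the rest of the word. *)
Lemma decreasing_runs_ind (Q : seq (seq nat) -> Prop) :
  Q [::] ->
  (forall a r rs, 0 < a -> path ltn a r -> head 0 (flatten rs) < a ->
     decreasing_runs rs -> Q rs -> Q ((a :: r) :: rs)) ->
  forall rs, decreasing_runs rs -> Q rs.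
Proof.
move=> Q0 QS; elim=> // r rs IH.
case/andP=> /= /andP[/increasing_runP[a [s [-> a0 sa]]] all_rs] hd.
have drs : decreasing_runs rs by rewrite /decreasing_runs all_rs; exact: path_sorted hd.
apply: QS => //; last exact: IH.
case: rs all_rs hd {IH drs} => // t rs /= /andP[/increasing_runP[b [t' [-> _ _]]] _].
by case/andP.
Qed.

Lemma flatten_decreasing_runs_eq0 rs :
  decreasing_runs rs -> (flatten rs == [::]) = (rs == [::]).
Proof. by case: rs => // -[]. Qed.

Lemma contains132_flatten rs : decreasing_runs rs -> ~~ contains132 (flatten rs).
Proof.
elim/decreasing_runs_ind=> {rs} // a r rs _ ar lt_a _ IH.
by rewrite [flatten _]/= -cat_cons contains132_run.
Qed.

Lemma des_flatten rs :
  decreasing_runs rs -> rs != [::] -> des (flatten rs) + 1 = size rs.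
Proof.
elim/decreasing_runs_ind=> {rs} // a r rs _ ar lt_a drs IH _.
rewrite [flatten _]/= -cat_cons des_run // flatten_decreasing_runs_eq0 //=.
by case: (eqVneq rs [::]) IH => [->|_ <-] //; rewrite addn1.
Qed.

Lemma rpk_flatten rs :
  decreasing_runs rs -> rpk (flatten rs) = count (fun r => 2 <= size r) rs.
Proof.
elim/decreasing_runs_ind=> {rs} // a r rs _ ar lt_a _ IH.
by rewrite [flatten _]/= -cat_cons rpk_run //= IH; case: r {ar}.
Qed.

Lemma exddes_flatten rs :
  decreasing_runs rs -> exddes (flatten rs) = count (fun r => size r == 1) rs.
Proof.
elim/decreasing_runs_ind=> {rs} // a r rs _ ar lt_a _ IH.
by rewrite [flatten _]/= -cat_cons exddes_run //= IH; case: r {ar}.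
Qed.

(** The decomposition into runs with decreasing minima is unique, since such
    minima force a descent at each junction.  This gives the injectivity of the
    bijection. *)
Lemma runs_flatten rs : decreasing_runs rs -> runs (flatten rs) = rs.
Proof.
elim/decreasing_runs_ind=> {rs} // a r rs _ ar lt_a drs IH.
rewrite [flatten _]/= -cat_cons; elim: r a ar lt_a => [|b s IHs] c /=.
  move=> _; rewrite IH; case: rs {IH} drs => //= r rs.
  case/andP=> /= /andP[/increasing_runP[b [s [-> _ _]]] _ _] /= lt_bc.
  by rewrite ltnNge ltnW.
move=> /andP[cb bs] lt_c.
by rewrite /= in IHs; rewrite IHs //= ?cb //; exact: ltn_trans cb.
Qed.

Lemma flatten_runs w : flatten (runs w) = w.
Proof.
by elim: w => //= a w; case: (runs w) => [<-|r rs] //=; case: ifP => _ /= ->.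
Qed.

Lemma runs_increasing w : all (ltn 0) w -> all increasing_run (runs w).
Proof.
elim: w => //= a w IH /andP[a0 /IH]; case: (runs w) => [|r rs] /=.
  by rewrite /increasing_run /= a0.
case/andP=> /increasing_runP[b [s [-> b0 bs]]] inc.
by case: ifP => /= ab; rewrite /increasing_run /= a0 ?ab ?b0 ?bs.
Qed.

(** The runs are maximal. *)
Lemma runs_junction w :
  sorted (fun r r' => head 0 r' <= last 0 r) (runs w).
Proof.
elim: w => //= a w; case: (runs w) => //= r rs; case: ifP => [lt_a|/negbT] /=.
  by case: rs r lt_a => //= t rs [].
by rewrite -leqNgt => ->.
Qed.

Lemma decreasing_runs_cons a r rs :
  0 < a -> path ltn a r -> head 0 (flatten rs) < a -> decreasing_runs rs ->
  decreasing_runs ((a :: r) :: rs).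
Proof.
move=> a0 ar lt_a /andP[inc hd].
rewrite /decreasing_runs /= inc /increasing_run /= a0 ar /=.
case: rs lt_a inc hd => //= t rs lt_a /andP[/increasing_runP[b [s [t_def _ _]]] _].
by rewrite t_def /= in lt_a *; rewrite lt_a.
Qed.

(** Each run is truncated to an initial segment, so its minimum is unchanged
    unless the whole run disappears. *)
Lemma restrict_flatten k rs :
  decreasing_runs rs ->
  exists2 rs', decreasing_runs rs' & flatten rs' = restrict_word k (flatten rs).
Proof.
move=> drs.
(* The bound on the first letter is what lets the induction prepend a run. *)
suff [rs' [? ? _]] : exists rs', [/\ decreasing_runs rs',
    flatten rs' = restrict_word k (flatten rs) &
    head 0 (flatten rs') <= head 0 (flatten rs)] by exists rs'.
elim/decreasing_runs_ind: rs / drs => [|a r rs a0 ar lt_a _]; first by exists [::].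
case=> rs' [drs' E le_hd].
rewrite [flatten (_ :: _)]/= -cat_cons /restrict_word filter_cat.
have [le_ak|lt_ka] := leqP a k; last first.
  exists rs'; split=> //; last by rewrite (leq_trans le_hd) //= ltnW.
  rewrite E (@eq_in_filter _ _ pred0) ?filter_pred0 // => b.
  rewrite in_cons => /predU1P[->|br]; first by rewrite [_ <= k]leqNgt lt_ka andbF.
  have /allP/(_ b br) /= ab := order_path_min ltn_trans ar.
  by rewrite [_ <= k]leqNgt (ltn_trans lt_ka ab) andbF.
exists ((a :: restrict_word k r) :: rs'); split=> //=; last 1 first.
- by rewrite E a0 le_ak.
apply: decreasing_runs_cons => //; last exact: leq_ltn_trans lt_a.
by apply: (subseq_path ltn_trans) ar; exact: filter_subseq.
Qed.

Lemma avoids_of_decreasing_runs rs :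
  decreasing_runs rs -> avoids_simsun132 (flatten rs).
Proof.
move=> drs; apply/allP=> k _; have [rs' drs' <-] := restrict_flatten k drs.
exact: contains132_flatten.
Qed.

(** The letter [k] is the first letter of [r] above [c], so that the restriction
    to [k] erases what separates [k] from [c]. *)
Lemma simsun132_witness r (c : nat) u :
  increasing_run r -> c \notin r -> 0 < c -> head 0 r < c < last 0 r ->
  exists2 k, k \in r & contains132 (restrict_word k (r ++ c :: u)).
Proof.
case/increasing_runP=> a [s [-> a0 sa]] {r}.
elim: s a a0 sa => [|b s IH] a a0 /=; first by move=> _ _ _; lia.
case/andP=> ab bs cNr c0 /andP[ac cl].
have /norP[/norP[c_a c_b] cNs] : ~~ ((c == a) || (c == b) || (c \in s)).
  by move: cNr; rewrite !in_cons orbA.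
have [bc|cb|bc] := ltngtP b c; last by rewrite bc eqxx in c_b.
- have [||||k kbs ck] := IH b _ bs; rewrite ?in_cons ?(negPf c_b) ?bc //.
    exact: ltn_trans ab.
  exists k; first by rewrite in_cons kbs orbT.
  by have := contains132_catr (restrict_word k [:: a]) ck; rewrite -filter_cat.
(* Here a < c < b are the letters of the pattern, and the rest of [r] exceeds b. *)
exists b; first by rewrite !in_cons eqxx orbT.
rewrite /restrict_word /= a0 (ltnW ab) (ltn_trans a0 ab) leqnn /= filter_cat.
rewrite (@eq_in_filter _ _ pred0 s) ?filter_pred0 => [|d ds].
  by rewrite /= c0 (ltnW cb) contains132_cons /letter /= ac cb.
have /allP/(_ d ds) /= bd := order_path_min ltn_trans bs.
by rewrite [d <= b]leqNgt bd andbF.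
Qed.

(** For two consecutive runs, the head of the second is below the last letter of
    the first by maximality; avoidance then forces it below the head of the
    first as well. *)
Lemma decreasing_runs_of_avoids w :
  uniq w -> {in w, forall a, 1 <= a <= size w} -> avoids_simsun132 w ->
  decreasing_runs (runs w).
Proof.
move=> w_uniq w_bd /allP av.
have {av} av k : k \in w -> ~~ contains132 (restrict_word k w).
  by move/w_bd => bd; apply: av; rewrite mem_iota add1n ltnS.
have inc : all increasing_run (runs w).
  by apply: runs_increasing; apply/allP=> a /w_bd /andP[].
rewrite /decreasing_runs inc /=.
move: (flatten_runs w) (runs_junction w) inc => E.
rewrite -E in av w_uniq; elim: (runs w) av w_uniq {E w_bd} => // r rs IH.
case: rs IH => // t rs IH av w_uniq.
rewrite [sorted _ _]/= => /andP[le_tr junc] /andP[inc_r inc].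
rewrite [sorted _ _]/=; apply/andP; split; last first.
  apply: IH => // [k k_in|]; last first.
    by move: w_uniq; rewrite [flatten _]/= cat_uniq => /and3P[].
  have: k \in flatten [:: r, t & rs] by rewrite /= mem_cat k_in orbT.
  move/av; apply: contra; rewrite /restrict_word [flatten (r :: _)]/= filter_cat.
  exact: contains132_catr.
move: inc => /andP[/increasing_runP[c [s [t_def c0 _]]] _].
rewrite {}t_def /= in le_tr av w_uniq *; rewrite /= ltnNge; apply/negP=> le_rc.
have cNr : c \notin r.
  by move: w_uniq; rewrite cat_uniq /= => /and3P[_ /norP[]].
have [a [s' [r_def _ _]]] := increasing_runP _ inc_r.
have hr : head 0 r \in r by rewrite r_def mem_head.
have lr : last 0 r \in r by rewrite r_def /= mem_last.
have rcr : head 0 r < c < last 0 r.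
  rewrite !ltn_neqAle le_rc le_tr !andbT.
  by apply/andP; split; apply: contraNneq cNr => E; [rewrite -E|rewrite E].
have [k kr] := simsun132_witness (s ++ flatten rs) inc_r cNr c0 rcr.
by apply/negP; apply: av; rewrite mem_cat kr.
Qed.

(** * The word of a set partition *)

(** Needed to turn [min_block], a [minn] over a set, into a [minn] over the list
    of its elements. *)
HB.instance Definition _ := SemiGroup.isComLaw.Build nat minn minnA minnC.

(** For c < d, the letter [d] precedes [c] in the concatenation of the lists taken
    in reverse order exactly when its list has the larger index: within one
    increasing list [c] comes first. *)
Lemma index_flatten_rev (bs : seq (seq nat)) c d :
  uniq (flatten (rev bs)) -> all (sorted ltn) bs -> c < d ->
  c \in flatten (rev bs) -> d \in flatten (rev bs) ->
  reflect (exists s t, [/\ s < t < size bs,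
                       c \in nth [::] bs s & d \in nth [::] bs t])
          (index d (flatten (rev bs)) < index c (flatten (rev bs))).
Proof.
move=> uf sf cd.
have in_flat e i (l : seq (seq nat)) : e \in nth [::] l i -> e \in flatten (rev l).
  move=> ei; have [lt_i|] := ltnP i (size l); last first.
    by move/(nth_default [::]) => E; rewrite E in ei.
  by apply/flattenP; exists (nth [::] l i); rewrite // mem_rev mem_nth.
elim: bs uf sf => // b bs IH; rewrite rev_cons flatten_rcons cat_uniq.
case/and3P=> uF /hasPn Fb ub /= /andP[sb sbs]; rewrite !mem_cat !index_cat.
have {}Fb e : e \in b -> e \in flatten (rev bs) -> False.
  by move=> /Fb /= /negP.
have [cF|cF] := boolP (c \in _); have [dF|dF] := boolP (d \in _) => //= cb db.
- apply: (iffP (IH uF sbs cF dF)) => [[s [t [? ? ?]]]|]; first by exists s.+1, t.+1.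
  case=> -[|s] [[|t] [//= ? cs dt]]; first by case: (Fb c).
  by exists s, t.
- apply: (iffP idP) => [|[s [[|t] [/=]]]]; rewrite ?andbF //.
    by move/(leq_ltn_trans (leq_addr _ _)); rewrite ltnNge index_size.
  by move=> _ _ /in_flat dt; rewrite dt in dF.
- rewrite -index_mem in dF *; rewrite (leq_trans dF) ?leq_addr //; constructor.
  move: dF; rewrite index_mem => /flattenP[r]; rewrite mem_rev => rbs dr.
  exists 0, (index r bs).+1; split; rewrite //= ?ltnS ?index_mem //.
  by rewrite nth_index.
- rewrite ltn_add2l; apply: (iffP idP) => [|[s [[|t] [/=]]]]; rewrite ?andbF //.
    by move/(sorted_ltn_index ltn_trans sb _ _ db cb) => /=; rewrite ltnNge ltnW.
  by move=> _ _ /in_flat dt; rewrite dt in dF.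
Qed.

Section PartitionWord.

Variable n : nat.
Implicit Types (B : {set 'I_n}) (P : {set {set 'I_n}}) (i : 'I_n).

(** The enumeration of a subset of ['I_n] is already increasing. *)
Definition block_word B : seq nat := [seq (i : nat).+1 | i <- enum B].

Definition block_words P : seq (seq nat) :=
  rev [seq block_word B | B <- standard_form P].

Definition partition_word P : seq nat := flatten (block_words P).

Lemma succ_ord_inj : injective (fun i => (i : nat).+1).
Proof. by move=> i j [/val_inj]. Qed.

Lemma mem_block_word B i : (i.+1 \in block_word B) = (i \in B).
Proof. by rewrite (mem_map succ_ord_inj) mem_enum. Qed.

Lemma block_wordP B a : reflect (exists2 i, i \in B & a = i.+1) (a \in block_word B).
Proof.
apply: (iffP mapP) => -[i]; first by rewrite mem_enum; exists i.
by exists i; rewrite ?mem_enum.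
Qed.

Lemma block_word_inj : injective block_word.
Proof. by move=> B C E; apply/setP=> i; rewrite -!mem_block_word E. Qed.

Lemma block_word_sorted B : sorted ltn (block_word B).
Proof.
rewrite /enum_mem sorted_map; apply: sorted_filter.
  by move=> i j k; exact: ltn_trans.
rewrite -enumT (_ : relpre _ _ = relpre val ltn) // -sorted_map val_enum_ord.
exact: iota_ltn_sorted.
Qed.

Lemma block_word_increasing B : B != set0 -> increasing_run (block_word B).
Proof.
case/set0Pn=> i iB; apply/andP; split.
  by apply/eqP=> E; move: iB; rewrite -mem_block_word E.
rewrite (path_sortedE ltn_trans) block_word_sorted andbT.
by apply/allP=> a /block_wordP[j _ ->].
Qed.

(** Links the order of [standard_form] to the decreasing run minima. *)
Lemma head_block_word B : B != set0 -> head 0 (block_word B) = (min_block B).+1.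
Proof.
move/block_word_increasing; rewrite /min_block -big_enum.
have := block_word_sorted B; rewrite /block_word.
move: (enum B) => [|i s] //= is_s _.
rewrite big_cons; congr _.+1; symmetry; apply/minn_idPl.
rewrite big_seq; apply: (big_ind (fun m => i <= m)) => [|a b|j js].
- exact: ltnW.
- by rewrite leq_min => -> ->.
- have /allP := order_path_min ltn_trans is_s.
  by move/(_ j.+1); rewrite (mem_map succ_ord_inj) => /(_ js) /ltnW.
Qed.

Lemma mem_standard_form P B : (B \in standard_form P) = (B \in P).
Proof. by rewrite mem_sort mem_enum. Qed.

Lemma mem_block_words P r :
  reflect (exists2 B, B \in P & r = block_word B) (r \in block_words P).
Proof.
rewrite mem_rev; apply: (iffP mapP) => -[B].
  by rewrite mem_standard_form; exists B.
by exists B; rewrite ?mem_standard_form.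
Qed.

Lemma block_words_inj : injective block_words.
Proof.
move=> P Q E; apply/setP=> B; rewrite -!mem_standard_form.
by rewrite -!(mem_map block_word_inj) -!(mem_rev (map _ _)) -/(block_words _) E.
Qed.

Lemma size_block_words P : size (block_words P) = block P.
Proof. by rewrite size_rev size_map size_sort -cardE. Qed.

Lemma count_block_words (p : pred nat) P :
  count (fun r => p (size r)) (block_words P) = #|[set B in P | p #|B| ]|.
Proof.
rewrite count_rev count_map /standard_form.
have /seq.permP-> := permEl (perm_sort (fun B C => min_block B <= min_block C) (enum P)).
rewrite -size_filter cardE /enum_mem -filter_predI; congr size.
by apply: eq_filter => B; rewrite !inE /= size_map -cardE andbC.
Qed.

Variable P : {set {set 'I_n}}.
Hypothesis partP : partition P [set: 'I_n].

Lemma partition_block_neq0 B : B \in P -> B != set0.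
Proof. by case/and3P: partP => _ _ + BP; apply: contraNneq => <-. Qed.

Lemma partition_block_eq B C i : B \in P -> C \in P -> i \in B -> i \in C -> B = C.
Proof.
case/and3P: partP => _ tP _ BP CP iB iC.
by rewrite -(def_pblock tP BP iB) (def_pblock tP CP iC).
Qed.

Lemma block_words_decreasing : decreasing_runs (block_words P).
Proof.
apply/andP; split.
  apply/allP=> r /mem_block_words[B BP ->].
  exact/block_word_increasing/partition_block_neq0.
rewrite /block_words map_rev rev_sorted.
have -> : [seq head 0 r | r <- [seq block_word B | B <- standard_form P]] =
          [seq (min_block B).+1 | B <- standard_form P].
  rewrite -map_comp; apply/eq_in_map => B; rewrite mem_standard_form => BP.
  exact/head_block_word/partition_block_neq0.
rewrite -[sorted _ _]/(sorted ltn _) ltn_sorted_uniq_leq; apply/andP; split.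
  rewrite map_inj_in_uniq ?sort_uniq ?enum_uniq // => B C.
  rewrite !mem_standard_form => BP CP.
  have [B0 C0] := (partition_block_neq0 BP, partition_block_neq0 CP).
  rewrite -!head_block_word // => E.
  (* Blocks with equal minima share that minimum, hence are equal. *)
  have inB D : D != set0 -> exists2 i, i \in D & head 0 (block_word D) = i.+1.
    move/block_word_increasing/increasing_runP=> [a [s [D_def _ _]]].
    by apply/block_wordP; rewrite D_def mem_head.
  have [[i iB iE] [j jC jE]] := (inB B B0, inB C C0).
  have ij : i = j by apply: succ_ord_inj; rewrite -iE -jE.
  by apply: (partition_block_eq BP CP iB); rewrite ij.
by rewrite sorted_map; apply: sort_sorted => B C; exact: leq_total.
Qed.

Lemma partition_word_perm : perm_eq (partition_word P) (iota 1 n).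
Proof.
have covP i : i.+1 \in partition_word P.
  case/and3P: partP => /eqP covP _ _.
  have /bigcupP[B BP iB] : i \in cover P by rewrite covP inE.
  apply/flattenP; exists (block_word B); last by rewrite mem_block_word.
  by apply/mem_block_words; exists B.
have memE : iota 1 n =i partition_word P.
  move=> a; rewrite mem_iota add1n ltnS; apply/idP/idP.
  - by case: a => // a lt_an; exact: (covP (Ordinal lt_an)).
  - by case/flattenP=> r /mem_block_words[B _ ->] /block_wordP[i _ ->] /=.
(* The word has n letters and contains all of [n], so it has no repetition. *)
have sz : size (partition_word P) = n.
  rewrite size_flatten /shape sumnE big_map /block_words.
  rewrite (perm_big _ (permEl (perm_rev _))) big_map.
  rewrite (perm_big _ (permEl (perm_sort _ _))) big_enum /=.
  under eq_bigr do rewrite size_map -cardE.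
  by rewrite -(card_partition partP) cardsT card_ord.
rewrite perm_sym uniq_perm ?iota_uniq //.
by apply: (leq_size_uniq (iota_uniq 1 n)) => [a|]; rewrite ?memE // sz size_iota.
Qed.

Lemma partition_word_uniq : uniq (partition_word P).
Proof. by rewrite (perm_uniq partition_word_perm) iota_uniq. Qed.

Lemma mem_partition_word i : i.+1 \in partition_word P.
Proof. by rewrite (perm_mem partition_word_perm) mem_iota /= add1n ltnS. Qed.

(** A position-based form of free rises, to be compared with inversions. *)
Lemma frE :
  fr P = \sum_(cd : 'I_n * 'I_n | (cd.1 < cd.2) &&
           (index cd.2.+1 (partition_word P) < index cd.1.+1 (partition_word P))) 1.
Proof.
rewrite /fr -sum1_card; apply: eq_bigl => -[c d]; rewrite inE /=.
have [lt_cd|] := ltnP c d; last first.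
  by move=> _; apply/existsP=> -[s /existsP[t /and4P[_ _ _]]].
have nthE (e : 'I_n) k (lt_k : k < block P) :
    (e.+1 \in nth [::] [seq block_word B | B <- standard_form P] k) =
    (e \in nth set0 (standard_form P) k).
  by rewrite (nth_map set0) ?mem_block_word // size_sort -cardE.
have sz : size [seq block_word B | B <- standard_form P] = block P.
  by rewrite -size_block_words size_rev.
rewrite andTb; have := @index_flatten_rev [seq block_word B | B <- standard_form P]
  c.+1 d.+1.
case/(_ partition_word_uniq _ lt_cd (mem_partition_word _) (mem_partition_word _)).
- by apply/allP=> r /mapP[B _ ->]; exact: block_word_sorted.
- rewrite sz => -[s [t [/andP[lt_st lt_t] cs dt]]].
  have lt_s := ltn_trans lt_st lt_t; rewrite !nthE // in cs dt.
  apply/existsP; exists (Ordinal lt_s); apply/existsP; exists (Ordinal lt_t).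
  exact/and4P.
- move=> nst; apply/existsP=> -[s /existsP[t /and4P[lt_st cs dt _]]].
  by case: nst; exists s, t; rewrite sz lt_st !nthE ?ltn_ord.
Qed.

End PartitionWord.

(** * The bijection with avoiding permutations *)

Lemma uniq_flatten_mem_eq (T : eqType) (rs : seq (seq T)) r t a :
  uniq (flatten rs) -> r \in rs -> t \in rs -> a \in r -> a \in t -> r = t.
Proof.
elim: rs => // u us IH.
rewrite [flatten _]/= cat_uniq => /and3P[_ /hasPn disj uus].
have no_us v : v \in us -> a \in v -> a \in u -> False.
  move=> vus av au; have /disj /negP[] // : a \in flatten us.
  by apply/flattenP; exists v.
rewrite !in_cons => /predU1P[->|rus] /predU1P[->|tus] ar at_ //; last exact: IH.
- by case: (no_us t).
- by case: (no_us r).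
Qed.

Section WordOfPerm.

Variable n : nat.
Implicit Types s : 'S_n.

Lemma size_word_of_perm s : size (word_of_perm s) = n.
Proof. by rewrite size_map size_enum_ord. Qed.

Lemma letter_word_of_perm s (i : 'I_n) : letter (word_of_perm s) i.+1 = (s i).+1.
Proof. by rewrite /letter /= (nth_map i) ?size_enum_ord // nth_ord_enum. Qed.

Lemma word_of_perm_inj : injective (@word_of_perm n).
Proof.
move=> s t E; apply/permP=> i; apply: succ_ord_inj.
by rewrite -!letter_word_of_perm E.
Qed.

Lemma word_of_perm_uniq s : uniq (word_of_perm s).
Proof.
by rewrite map_inj_uniq ?enum_uniq // => i j /succ_ord_inj /perm_inj.
Qed.

Lemma mem_word_of_perm s a : (a \in word_of_perm s) = (1 <= a <= n).
Proof.
apply/mapP/idP=> [[i _ ->]|]; first exact: ltn_ord.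
case: a => // a /= lt_an.
by exists (s^-1%g (Ordinal lt_an)); rewrite ?mem_enum ?permKV.
Qed.

Lemma index_word_of_perm s (i : 'I_n) : index (s i).+1 (word_of_perm s) = i.
Proof.
rewrite (index_map (f := fun i => (s i).+1)) ?index_enum_ord // => j k.
by move/succ_ord_inj/perm_inj.
Qed.

Lemma word_of_perm_exists w :
  perm_eq w (iota 1 n) -> exists s, word_of_perm s = w.
Proof.
have -> : iota 1 n = iota_tuple n 1 by [].
case/tuple_permP=> s ->; exists s; apply: eq_map => i.
by rewrite (tnth_nth 0) nth_iota.
Qed.

Lemma inversionsE s :
  inversions (word_of_perm s) =
    \sum_(ij : 'I_n * 'I_n | (ij.1 < ij.2) && (s ij.2 < s ij.1)) 1.
Proof.
rewrite /inversions size_word_of_perm -sum1_count big_mkcond big_allpairs /=.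
have -> : iota 1 n = index_iota 1 n.+1 by rewrite /index_iota subn1.
rewrite big_add1 big_mkord [RHS]big_mkcond.
rewrite -(pair_bigA _ (fun i j : 'I_n => if (i < j) && (s j < s i) then 1 else 0)) /=.
apply: eq_bigr => i _; rewrite big_add1 big_mkord.
by apply: eq_bigr => j _; rewrite !letter_word_of_perm !ltnS.
Qed.

(** An inversion at positions i < j is the free rise (s j, s i), the smaller
    letter coming first. *)
Lemma inversions_fr s (P : {set {set 'I_n}}) :
  partition P [set: 'I_n] -> word_of_perm s = partition_word P ->
  inversions (word_of_perm s) = fr P.
Proof.
move=> partP sP; rewrite inversionsE frE // -sP.
rewrite [RHS](reindex_inj (h := fun ij => (s ij.2, s ij.1))) /=; last first.
  by move=> [i j] [k l] [/perm_inj-> /perm_inj->].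
by apply: eq_bigl => -[i j] /=; rewrite !index_word_of_perm andbC.
Qed.

(** The default value is never reached on partitions, by
    [perm_of_partitionK]. *)
Definition perm_of_partition (P : {set {set 'I_n}}) : 'S_n :=
  odflt 1%g [pick s | word_of_perm s == partition_word P].

Lemma perm_of_partitionK P :
  partition P [set: 'I_n] -> word_of_perm (perm_of_partition P) = partition_word P.
Proof.
move=> partP; rewrite /perm_of_partition; case: pickP => [s /eqP //|no_s].
have [s sP] := word_of_perm_exists (partition_word_perm partP).
by have := no_s s; rewrite sP eqxx.
Qed.

Lemma perm_of_partition_inj :
  {in [set P | partition P [set: 'I_n]] &, injective perm_of_partition}.
Proof.
move=> P Q; rewrite !inE => partP partQ E; apply: block_words_inj.
rewrite -(runs_flatten (block_words_decreasing partP)).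
rewrite -(runs_flatten (block_words_decreasing partQ)).
by rewrite -!/(partition_word _) -!perm_of_partitionK // E.
Qed.

(** Surjectivity: the runs, as sets, form a partition.  Its standard form gives
    back the runs in their order because both lists have the same members and
    strictly decreasing minima, and such a list is determined by its members. *)
Lemma partition_of_decreasing_runs rs :
  decreasing_runs rs -> uniq (flatten rs) ->
  (forall a, (a \in flatten rs) = (1 <= a <= n)) ->
  exists2 P : {set {set 'I_n}}, partition P [set: 'I_n] & block_words P = rs.
Proof.
move=> drs urs mem_rs.
pose blk (r : seq nat) := [set i : 'I_n | i.+1 \in r].
pose P : {set {set 'I_n}} := [set B in [seq blk r | r <- rs]].
have memP B : reflect (exists2 r, r \in rs & B = blk r) (B \in P).
  by rewrite inE; exact: mapP.
have inc r : r \in rs -> increasing_run r by case/andP: drs => /allP/(_ r).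
have blkE r : r \in rs -> block_word (blk r) = r.
  move=> r_rs; apply: (irr_sorted_eq ltn_trans ltnn (block_word_sorted _)).
    by have /andP[_ /path_sorted] := inc r r_rs.
  move=> a; apply/block_wordP/idP => [[i + ->]|ar]; first by rewrite inE.
  have := mem_rs a; have -> : a \in flatten rs by apply/flattenP; exists r.
  case: a ar => // a ar /esym /= lt_an.
  by exists (Ordinal lt_an); rewrite ?inE.
have run_eq r t a := @uniq_flatten_mem_eq _ rs r t a urs.
have partP : partition P [set: 'I_n].
  apply/and3P; split.
  - rewrite eqEsubset subsetT /=; apply/subsetP=> i _.
    have /flattenP[r r_rs ir] : i.+1 \in flatten rs by rewrite mem_rs /=.
    by apply/bigcupP; exists (blk r); rewrite ?inE //; apply: map_f.
  - apply/trivIsetP=> B C /memP[r r_rs ->] /memP[t t_rs ->].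
    apply: contraR => /pred0Pn[i /andP[]]; rewrite !inE => ir it.
    by rewrite (run_eq r t i.+1).
  - apply/memP=> -[r r_rs E]; have := inc r r_rs.
    by rewrite -(blkE r r_rs) -E /block_word enum_set0.
exists P => //.
have dP := block_words_decreasing partP.
have head_sorted ts : decreasing_runs ts -> sorted (fun r t => head 0 r > head 0 t) ts.
  by case/andP=> _; rewrite sorted_map.
apply: (irr_sorted_eq _ _ (head_sorted _ dP) (head_sorted _ drs)) => [r t u||r].
- by move=> tr ru; exact: ltn_trans tr.
- by move=> r; rewrite ltnn.
- apply/mem_block_words/idP => [[_ /memP[t t_rs ->] ->]|r_rs]; first by rewrite blkE.
  by exists (blk r); rewrite ?blkE //; apply/memP; exists r.
Qed.

Lemma image_perm_of_partition s :
  (s \in perm_of_partition @: [set P | partition P [set: 'I_n]]) =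
    avoids_simsun132 (word_of_perm s).
Proof.
apply/imsetP/idP=> [[P] |av].
  rewrite inE => partP ->; rewrite perm_of_partitionK //.
  exact/avoids_of_decreasing_runs/block_words_decreasing.
have drs : decreasing_runs (runs (word_of_perm s)).
  apply: decreasing_runs_of_avoids av; first exact: word_of_perm_uniq.
  by move=> a; rewrite size_word_of_perm mem_word_of_perm.
have [||P partP PE] := partition_of_decreasing_runs drs; rewrite ?flatten_runs.
- exact: word_of_perm_uniq.
- exact: mem_word_of_perm.
exists P; rewrite ?inE //; apply: word_of_perm_inj.
by rewrite perm_of_partitionK // /partition_word PE flatten_runs.
Qed.

End WordOfPerm.

(** * The generating function identity *)

Local Open Scope ring_scope.

Theorem theorem12 (R : comNzRingType) (x y z q : R) (n : nat) (hn : (1 <= n)%N) :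
  \sum_(s : 'S_n | avoids_simsun132 (word_of_perm s))
     x ^+ (des (word_of_perm s) + 1) * y ^+ rpk (word_of_perm s)
       * z ^+ exddes (word_of_perm s) * q ^+ inversions (word_of_perm s)
  = \sum_(P : {set {set 'I_n}} | partition P [set: 'I_n])
     x ^+ block P * y ^+ nsingleton P * z ^+ singleton P * q ^+ fr P.
Proof.
rewrite (eq_bigl _ _ (fun s => esym (image_perm_of_partition s))).
rewrite big_imset; last exact: perm_of_partition_inj.
apply: eq_big => [P|P]; rewrite inE // => partP.
have wP := perm_of_partitionK partP.
have dP := block_words_decreasing partP.
rewrite (inversions_fr partP wP) wP des_flatten // ?rpk_flatten ?exddes_flatten //.
  by rewrite size_block_words !(count_block_words, count_block_words (pred1 1)).
rewrite -size_eq0 size_block_words -lt0n card_gt0.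
apply: contraTneq partP => ->; apply/negP=> /card_partition.
by rewrite big_set0 cardsT card_ord => n0; rewrite n0 in hn.
Qed.
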